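(* Let $g$ be a concave distortion function satisfying (A1) and (A2), and let $\mu\in\mathbb R$, $\sigma>0$ and $\varepsilon$ satisfy (A3). Put $c_0=\operatorname{corr}(F^{-1}(U),\gamma(U))$, $V=\operatorname{var}(\gamma(U))$, $C_{\gamma,F}=\operatorname{cov}(F^{-1}(U),\gamma(U))$ and $$K=\tfrac12\big(\mu_F^2+\sigma_F^2+\mu^2+\sigma^2-2\mu\mu_F-\varepsilon\big).$$ For $\lambda\ge 0$ define $$h_\lambda(u)=\mu+\sigma\,\frac{\gamma(u)+\lambda F^{-1}(u)-a_\lambda}{b_\lambda},\qquad 0<u<1,$$ where $a_\lambda=\mathbb E(\gamma(U)+\lambda F^{-1}(U))$ and $b_\lambda=\operatorname{std}(\gamma(U)+\lambda F^{-1}(U))$. 1. Suppose $c_0<1$ and $(\mu_F-\mu)^2+(\sigma_F-\sigma)^2<\varepsilon<(\mu_F-\mu)^2+(\sigma_F-\sigma)^2+2\sigma\sigma_F(1-c_0)$. Then $K\ge 0$, and the equation $d_W(F^{-1},h_\lambda)=\sqrt\varepsilon$ has a unique positive solution $\lambda$, namely $$\lambda=\frac{K}{\sigma_F^2}\sqrt{\frac{C_{\gamma,F}^2-V\sigma_F^2}{K^2-\sigma^2\sigma_F^2}}-\frac{C_{\gamma,F}}{\sigma_F^2}.$$ For this $\lambda$, the problem $\sup_{G\in\mathcal M_\varepsilon(\mu,\sigma)}H_g(G)$ has a unique maximiser, whose quantile function is $h_\lambda$. The supremum equals $$H_g(h_\lambda)=\mu+\frac{\sigma}{b_\lambda}\big(V+\lambda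 C_{\gamma,F}\big)=\mu+\sigma\operatorname{std}(\gamma(U))\operatorname{corr}\big(\gamma(U),\gamma(U)+\lambda F^{-1}(U)\big),$$ and it is a continuous function of $\varepsilon$. 2. Suppose $\varepsilon\ge(\mu_F-\mu)^2+(\sigma_F-\sigma)^2+2\sigma\sigma_F(1-c_0)$ (this includes $\varepsilon=+\infty$). Then the unique maximiser has quantile function $h_0$, and the supremum equals $\mu+\sigma\operatorname{std}(\gamma(U))$.
   Context: Let $(\Omega,\mathcal A,\mathbb P)$ be an atomless probability space and $U\sim\mathcal U(0,1)$. $\mathcal M^2$ denotes the set of distribution functions on $\mathbb R$ with finite second moment. For $G\in\mathcal M^2$, $G^{-1}(u)=\inf\{y:G(y)\ge u\}$ is its left-continuous quantile function. A distortion function is a non-decreasing $g:[0,1]\to[0,1]$ with $g(0)=0$, $g(1)=1$. For absolutely continuous $g$ let $\gamma(u)=\partial_-g(x)|_{x=1-u}$ (left derivative), $0<u<1$; then $\int_0^1\gamma=1$. The distortion risk measure is $H_g(G)=\int_0^1\gamma(u)G^{-1}(u)\,du$, also written $H_g(G^{-1})$. Standing assumptions: - (A1) $g$ is absolutely continuous and $\int_0^1\gamma(u)^2du<\infty$; - (A2) $\gamma$ is not (a.e.) identically $1$. The order-2 Wasserstein distance is $d_W(G_1,G_2)=\big(\int_0^1(G_1^{-1}(u)-G_2^{-1}(u))^2du\big)^{1/2}$. A reference distribution $F\in\mathcal M^2$ is fixed, with mean $\mu_F$ and standard deviation $\sigma_F>0$. For $\mu\in\mathbb R$, $\sigma>0$,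 $0\le\varepsilon\le\infty$: $$\mathcal M_\varepsilon(\mu,\sigma)=\Big\{G\in\mathcal M^2:\int x\,dG=\mu,\ \int x^2dG=\mu^2+\sigma^2,\ d_W(F,G)\le\sqrt\varepsilon\Big\},$$ and $\mathcal M(\mu,\sigma)=\mathcal M_\infty(\mu,\sigma)$. - (A3) $\varepsilon>(\mu_F-\mu)^2+(\sigma_F-\sigma)^2$. Uniqueness of an optimiser refers to its quantile function.
   Formalization: The maximiser's quantile function is stated to equal h_λ (resp. h_0) for almost every u in (0,1): pointwise equality fails at jumps of γ, e.g. g(x)=min(2x,1) at u=1/2, where h_λ is not left-continuous. *)

(* Defs.v *)
From HB Require Import structures.
From mathcomp Require Import all_boot all_order all_algebra.
From mathcomp Require Import all_classical all_reals all_analysis.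
Set Implicit Arguments. Unset Strict Implicit. Unset Printing Implicit Defensive.
Import Order.TTheory GRing.Theory Num.Theory.
Import numFieldNormedType.Exports.
Local Open Scope classical_set_scope.
Local Open Scope ring_scope.

Section defs.
Variable R : realType.

Definition cdf (G : probability R R) (x : R) : R := fine (G [set y | y <= x]).

Definition quantile (G : probability R R) (u : R) : R :=
  inf [set y : R | u <= cdf G y].

Definition M2 (G : probability R R) : Prop :=
  G.-integrable setT (fun x => (x ^+ 2)%:E).

Definition mom1 (G : probability R R) : R := \int[G]_(x in setT) x.
Definition mom2 (G : probability R R) : R := \int[G]_(x in setT) (x ^+ 2).
Definition meanD (G : probability R R) : R := mom1 G.
Definition stdD (G : probability R R) : R := Num.sqrt (mom2 G - mom1 G ^+ 2).

(* ---------- functionals of U ~ U(0,1): E f(U) = int_0^1 f ---------- *)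
Definition EU (f : R -> R) : R := \int[lebesgue_measure]_(u in `]0, 1[) f u.
Definition covU (f1 f2 : R -> R) : R := EU (fun u => f1 u * f2 u) - EU f1 * EU f2.
Definition varU (f : R -> R) : R := covU f f.
Definition stdU (f : R -> R) : R := Num.sqrt (varU f).
Definition corrU (f1 f2 : R -> R) : R := covU f1 f2 / (stdU f1 * stdU f2).

Definition dWq (f1 f2 : R -> R) : R :=
  Num.sqrt (\int[lebesgue_measure]_(u in `]0, 1[) ((f1 u - f2 u) ^+ 2)).
Definition dW (G1 G2 : probability R R) : R := dWq (quantile G1) (quantile G2).

Definition distortion (g : R -> R) : Prop :=
  {in `[0, 1] &, {homo g : x y / x <= y}} /\
  (forall x, x \in `[0, 1] -> 0 <= g x <= 1) /\ g 0 = 0 /\ g 1 = 1.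

Definition concave_on01 (g : R -> R) : Prop :=
  forall x y t, x \in `[0, 1] -> y \in `[0, 1] -> t \in `[0, 1] ->
    t * g x + (1 - t) * g y <= g (t * x + (1 - t) * y).

Definition abs_continuous01 (g : R -> R) : Prop :=
  forall e : R, 0 < e -> exists2 d : R, 0 < d &
    forall (n : nat) (a b : 'I_n -> R),
      (forall i, 0 <= a i /\ a i <= b i /\ b i <= 1) ->
      (forall i j, i != j -> b i <= a j \/ b j <= a i) ->
      \sum_(i < n) (b i - a i) < d ->
      \sum_(i < n) `|g (b i) - g (a i)| < e.

Definition left_deriv (g : R -> R) (x : R) : R :=
  lim ((fun h => (g x - g (x - h)) / h) @ 0^'+).

Definition gammaD (g : R -> R) (u : R) : R := left_deriv g (1 - u).

Definition A1 (g : R -> R) : Prop :=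
  abs_continuous01 g /\
  lebesgue_measure.-integrable `]0, 1[ (fun u => ((gammaD g u) ^+ 2)%:E).

Definition A2 (g : R -> R) : Prop :=
  ~ {ae lebesgue_measure, forall u, u \in `]0, 1[ -> gammaD g u = 1}.

Definition Hq (g f : R -> R) : R := EU (fun u => gammaD g u * f u).
Definition HD (g : R -> R) (G : probability R R) : R := Hq g (quantile G).

Definition Meps (F : probability R R) (eps : \bar R) (mu sigma : R)
    (G : probability R R) : Prop :=
  M2 G /\ mom1 G = mu /\ mom2 G = mu ^+ 2 + sigma ^+ 2 /\
  ((dW F G)%:E <= sqrte eps)%E.

Definition supH (g : R -> R) (F : probability R R) (eps : \bar R) (mu sigma : R)
  : \bar R := ereal_sup [set (HD g G)%:E | G in Meps F eps mu sigma].

Definition maximiser (g : R -> R) (F : probability R R) (eps : \bar R)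
    (mu sigma : R) (G : probability R R) : Prop :=
  Meps F eps mu sigma G /\
  forall G', Meps F eps mu sigma G' -> HD g G' <= HD g G.

Definition qeq (f1 f2 : R -> R) : Prop :=
  {ae lebesgue_measure, forall u, u \in `]0, 1[ -> f1 u = f2 u}.

Definition hlam (g : R -> R) (F : probability R R) (mu sigma lam : R) (u : R) : R :=
  let w := fun v => gammaD g v + lam * quantile F v in
  mu + sigma * ((w u - EU w) / stdU w).

End defs.

(* Main.v *)
Require Import Defs.
From HB Require Import structures.
From mathcomp Require Import all_boot all_order all_algebra.
From mathcomp Require Import all_classical all_reals all_analysis.
From mathcomp Require Import measurable_realfun ring lra.
Set Implicit Arguments. Unset Strict Implicit. Unset Printing Implicit Defensive.
Import Order.TTheory GRing.Theory Num.Theory.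
Import numFieldNormedType.Exports.
Local Open Scope classical_set_scope.
Local Open Scope ring_scope.

(* On quantile functions the problem is Hilbertian: on the feasible set the mean
   and variance of [q = G^-1] are fixed, [H_g] is [mu + cov (gamma, q)] and the
   Wasserstein constraint reads [cov (F^-1, q) >= K].  For [lambda >= 0],
   Cauchy-Schwarz bounds [cov (gamma + lambda F^-1, q)] by [sigma b_lambda],
   with equality only at the standardised function [h_lambda].  If [h_0] is
   feasible it is the answer; otherwise [lambda] is the multiplier for which
   the constraint is active at [h_lambda].  Since [gamma] is nondecreasing,
   [h_lambda] is almost everywhere the quantile function of its own law. *)

(** * Square-integrable functions of a uniform variable *)

(** The bounds on [eps] are conditions on [K]. Expanding the squared distance turns [eps > D0] into
    [K < sigma * sF], so [K] stays strictly below the Cauchy-Schwarz bound for [cov (F^-1, q)].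
    Likewise [eps < D1] says that [cov (F^-1, h_0)] falls short of [K]. These two strict
    inequalities give every sign needed to solve for [lambda].

    Two facts about [gamma] need work. Its mean must be 1: this makes [H_g] equal to
    [mu + cov (gamma, q)], and with (A2) it makes [gamma] nonconstant. As [gamma] is a pointwise
    left derivative, the mean comes from comparing secants of [g] with the monotone [gamma], and
    absolute continuity takes care of the endpoints. Also [cov (F^-1, gamma) >= 0], by
    comonotonicity: this keeps [b_lambda] positive for all [lambda >= 0] and excludes the spurious
    root produced by squaring the equation for [lambda]. *)

Section square_integrable.
Variable R : realType.
Local Notation leb := (@lebesgue_measure R).
Local Notation I01 := (`]0, 1[%classic : set (measurableTypeR R)).
Implicit Types (f k : R -> R) (a b c : R).

Definition L1U f := leb.-integrable I01 (EFin \o f).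
(** Measurability of [f] is required separately because it does not follow from that of its
    square. *)
Definition L2U f := measurable_fun I01 f /\ L1U (fun u => f u ^+ 2).

Lemma lebesgue_measure01 : leb I01 = 1%E.
Proof. by rewrite lebesgue_measure_itv/= lte_fin ltr01 sube0. Qed.

Lemma L1U_cst c : L1U (cst c).
Proof.
apply/integrableP; split; first exact/measurable_EFinP/measurable_cst.
rewrite (eq_integral (cst `|c|%:E))// integral_cst//= lebesgue_measure01.
by rewrite mule1 ltry.
Qed.

Lemma L1U_lin a b f k : L1U f -> L1U k -> L1U (fun u => a * f u + b * k u).
Proof.
move=> hf hk; have mI : measurable I01 by [].
have := integrableD mI (integrableZl mI a hf) (integrableZl mI b hk).
by apply: eq_integrable.
Qed.

Lemma L1U_eq f k : {in I01, f =1 k} -> L1U f -> L1U k.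
Proof.
by move=> fk; apply: eq_integrable => // u uI /=; rewrite fk.
Qed.

Lemma L1U_dominated f k : measurable_fun I01 f -> L1U k ->
  (forall u, u \in I01 -> `|f u| <= k u) -> L1U f.
Proof.
move=> mf hk fk; apply: (le_integrable _ _ _ hk) => //.
  exact/measurable_EFinP.
move=> u uI /=; rewrite lee_fin (le_trans (fk _ _)) ?inE//.
exact: ler_norm.
Qed.

Lemma L2U_mul f k : L2U f -> L2U k -> L1U (fun u => f u * k u).
Proof.
move=> [mf hf] [mk hk]; apply: (L1U_dominated _ (L1U_lin 1 1 hf hk)).
  exact: measurable_funM.
(* The dominating function is [f ^ 2 + k ^ 2], by expanding [(f + k) ^ 2] and [(f - k) ^ 2]. *)
move=> u _ /=; rewrite ler_norml; apply/andP; split;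
  have := sqr_ge0 (f u + k u); have := sqr_ge0 (f u - k u);
  have := sqr_ge0 (f u); have := sqr_ge0 (k u); nra.
Qed.

Lemma L2U_cst c : L2U (cst c).
Proof. by split; [exact: measurable_cst|exact: (L1U_cst (c ^+ 2))]. Qed.

Lemma L2U_L1U f : L2U f -> L1U f.
Proof.
move=> hf; apply: (L1U_eq _ (L2U_mul hf (L2U_cst 1))) => u _.
by rewrite /cst /= mulr1.
Qed.

Lemma L2U_lin a b f k : L2U f -> L2U k -> L2U (fun u => a * f u + b * k u).
Proof.
move=> hf hk; split.
  by apply: measurable_funD; apply: measurable_funM;
    [exact: measurable_cst|exact: hf.1|exact: measurable_cst|exact: hk.1].
have h1 := L1U_lin (a ^+ 2) (b ^+ 2) hf.2 hk.2.
have h2 := L1U_lin 1 (2 * a * b) h1 (L2U_mul hf hk).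
by apply: (L1U_eq _ h2) => u _ /=; ring.
Qed.

Lemma EU_eq f k : {in I01, f =1 k} -> EU f = EU k.
Proof. by move=> fk; apply: eq_Rintegral. Qed.

Lemma EU_lin a b f k : L1U f -> L1U k ->
  EU (fun u => a * f u + b * k u) = a * EU f + b * EU k.
Proof.
move=> hf hk; have c0 := L1U_cst 0.
rewrite /EU RintegralD//.
- by rewrite !RintegralZl.
- by apply: (L1U_eq _ (L1U_lin a 0 hf c0)) => u _ /=; rewrite mul0r addr0.
- by apply: (L1U_eq _ (L1U_lin b 0 hk c0)) => u _ /=; rewrite mul0r addr0.
Qed.

Lemma EU_cst c : EU (cst c) = c.
Proof. by rewrite /EU Rintegral_cst//= lebesgue_measure01 mulr1. Qed.

Lemma EU_ge0 f : (forall u, u \in I01 -> 0 <= f u) -> 0 <= EU f.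
Proof. by move=> f0; apply: Rintegral_ge0 => u uI; apply: f0; rewrite inE. Qed.

Lemma qeqS (f1 f2 f3 f4 : R -> R) :
  (forall u, u \in `]0, 1[ -> f1 u = f2 u -> f3 u = f4 u) ->
  qeq f1 f2 -> qeq f3 f4.
Proof.
move=> imp; apply: (@filterS _ _ (ae_filter_ringOfSetsType leb)) => u h uI.
exact/imp/h.
Qed.

Lemma EU_eq0_ae f : L1U f -> (forall u, u \in I01 -> 0 <= f u) ->
  EU f = 0 -> qeq f (cst 0).
Proof.
move=> hf f0 Ef0; have mf := measurable_int _ hf.
have mI : measurable I01 by [].
have I0 : (\int[leb]_(u in I01) `|(EFin \o f) u| = 0)%E.
  transitivity (\int[leb]_(u in I01) (f u)%:E)%E.
    by apply: eq_integral => u uI /=; rewrite ger0_norm ?f0.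
  by rewrite -[LHS]fineK ?integrable_fin_num//; congr (_%:E).
have [+ _] := ae_eq_integral_abs leb mI mf.
move=> /(_ I0); apply: (@filterS _ _ (ae_filter_ringOfSetsType leb)) => u h uI.
by move: (h uI) => [].
Qed.

Lemma EU_sqr_eq0_ae f : L2U f -> EU (fun u => f u ^+ 2) = 0 -> qeq f (cst 0).
Proof.
move=> hf E0.
have := EU_eq0_ae hf.2 (fun u _ => sqr_ge0 (f u)) E0.
by apply: qeqS => u uI /eqP; rewrite sqrf_eq0 => /eqP.
Qed.

Lemma covUC f k : covU f k = covU k f.
Proof.
rewrite /covU mulrC; congr (_ - _).
by apply: EU_eq => u _; rewrite mulrC.
Qed.

Lemma covU_linl a b f1 f2 k : L2U f1 -> L2U f2 -> L2U k ->
  covU (fun u => a * f1 u + b * f2 u) k = a * covU f1 k + b * covU f2 k.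
Proof.
move=> h1 h2 hk; rewrite /covU.
rewrite (EU_lin _ _ (L2U_L1U h1) (L2U_L1U h2)).
rewrite (@EU_eq _ (fun u => a * (f1 u * k u) + b * (f2 u * k u))); last first.
  by move=> u _; ring.
rewrite (EU_lin _ _ (L2U_mul h1 hk) (L2U_mul h2 hk)); ring.
Qed.

Lemma covU_linr a b f1 f2 k : L2U f1 -> L2U f2 -> L2U k ->
  covU k (fun u => a * f1 u + b * f2 u) = a * covU k f1 + b * covU k f2.
Proof. by move=> h1 h2 hk; rewrite covUC covU_linl// !(covUC k). Qed.

Lemma covU_cstl c k : L1U k -> covU (cst c) k = 0.
Proof.
move=> hk; rewrite /covU EU_cst; have c0 := L1U_cst 0.
have -> : EU (fun u => cst c u * k u) = EU (fun u => c * k u + 0 * cst 0 u).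
  by apply: EU_eq => u _ /=; rewrite mul0r addr0.
by rewrite EU_lin// mul0r addr0 subrr.
Qed.

(** Splitting off the means leaves the covariance as the only mixed term. Both the Wasserstein
    constraint and the Cauchy-Schwarz inequality below are read off from this identity. *)
Lemma EU_sqr_sub f k : L2U f -> L2U k ->
  EU (fun u => (f u - k u) ^+ 2) =
  varU f - 2 * covU f k + varU k + (EU f - EU k) ^+ 2.
Proof.
move=> hf hk.
have h1 := L1U_lin 1 1 hf.2 hk.2.
have -> : EU (fun u => (f u - k u) ^+ 2) =
  EU (fun u => 1 * (1 * f u ^+ 2 + 1 * k u ^+ 2) + (- 2) * (f u * k u)).
  by apply: EU_eq => u _; ring.
rewrite (EU_lin _ _ h1 (L2U_mul hf hk)) (EU_lin _ _ hf.2 hk.2).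
rewrite /varU /covU.
have sq (j : R -> R) : EU (fun u => j u * j u) = EU (fun u => j u ^+ 2).
  by apply: EU_eq => u _; rewrite expr2.
rewrite !sq; ring.
Qed.

Lemma varU_ge0 f : L2U f -> 0 <= varU f.
Proof.
move=> hf; have := EU_sqr_sub hf (L2U_cst (EU f)).
rewrite EU_cst subrr expr0n/= addr0 /varU.
rewrite (covUC f) !covU_cstl; [|exact: L1U_cst|exact: L2U_L1U].
rewrite mulr0 subr0 addr0 => <-.
by apply: EU_ge0 => u _; exact: sqr_ge0.
Qed.

End square_integrable.

(** * Monotone functions on the unit interval and concave distortions *)

Section monotone_on_unit_interval.
Variable R : realType.
Local Notation leb := (@lebesgue_measure R).
Local Notation I01 := (`]0, 1[%classic : set (measurableTypeR R)).
Implicit Types (f k : R -> R).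

(** The endpoints are left out: at 0 the quantile is the default value of an unbounded [inf], and at
    1 [gammaD] looks at [g] outside the unit interval. *)
Definition nondecreasing01 f :=
  forall u v, 0 < u -> u <= v -> v < 1 -> f u <= f v.

Lemma nondecreasing01_measurable f : nondecreasing01 f -> measurable_fun I01 f.
Proof.
move=> fnd.
apply: (measurability (@RGenCInfty.G R)) => [|/= _ [_] [r] -> <-].
  exact: RGenCInfty.measurableE.
apply: is_interval_measurable => s t/=.
rewrite !in_itv/= !andbT => -[/andP[s0 s1] fs] [/andP[t0 t1] ft] u /andP[su ut].
split; first by apply/andP; split; [exact: lt_le_trans su|exact: le_lt_trans t1].
by rewrite in_itv/= andbT (le_trans fs)// fnd// (le_lt_trans ut).
Qed.

(** Over [n] equal pieces of [[a, b]] the bounds telescope to [(f b - f a) * (b - a) / n], which is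
    arbitrarily small even if [f] jumps. *)
Lemma increments_eq_of_secants f (Phi : R -> R) :
  (forall u v, 0 < u -> u <= v -> v < 1 ->
     `|Phi v - Phi u| <= (f v - f u) * (v - u)) ->
  forall a b, 0 < a -> a <= b -> b < 1 -> Phi a = Phi b.
Proof.
move=> H a b a0 ab b1.
have step n (d : R) : 0 <= d -> a + n%:R * d < 1 ->
    `|Phi (a + n%:R * d) - Phi a| <= (f (a + n%:R * d) - f a) * d.
  move=> d0; elim: n => [_|n IH].
    by rewrite mul0r addr0 !subrr normr0 mul0r.
  rewrite -natr1 => hn.
  have nd0 : 0 <= n%:R * d by rewrite mulr_ge0.
  have lt1 : a + n%:R * d < 1 by apply: le_lt_trans hn; lra.
  have := H (a + n%:R * d) (a + (n%:R + 1) * d).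
  move=> /(_ ltac:(lra) ltac:(lra) hn).
  have -> : a + (n%:R + 1) * d - (a + n%:R * d) = d by ring.
  move: (IH lt1); set x := Phi (a + n%:R * d); set y := Phi (a + _) => h1 h2.
  have -> : y - Phi a = (y - x) + (x - Phi a) by ring.
  apply: le_trans (ler_normD _ _) _.
  by apply: le_trans (lerD h2 h1) _; rewrite -mulrDl; apply: ler_wpM2r => //; lra.
apply/eqP; rewrite eq_sym -subr_eq0 -normr_le0 leNgt; apply/negP => pos.
set e := `|Phi b - Phi a| in pos; set M := (f b - f a) * (b - a).
pose n := (Num.truncn (M / e)).+1.
have n0 : (0 : R) < n%:R by rewrite ltr0n.
have hn : M / e < n%:R by rewrite truncnS_gt.
have d0 : 0 <= (b - a) / n%:R by rewrite divr_ge0 ?subr_ge0// ltW.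
have := step n ((b - a) / n%:R) d0.
have -> : a + n%:R * ((b - a) / n%:R) = b by field; rewrite gt_eqF.
move=> /(_ b1).
rewrite mulrA -/e ler_pdivlMr// leNgt => /negP; apply.
by rewrite [e * _]mulrC -ltr_pdivrMr.
Qed.

(** A fundamental theorem of calculus for monotone [f]: the secants of [k] and of the integral of
    [f] lie between the same values of [f], so the difference of the two functions is constant
    inside, and by continuity up to both ends. *)
Lemma EU_of_secants f k : L1U f -> nondecreasing01 f ->
  (forall u v, 0 < u -> u < v -> v < 1 ->
     f u * (v - u) <= k v - k u <= f v * (v - u)) ->
  k x @[x --> 0^'+] --> k 0 -> k x @[x --> 1^'-] --> k 1 ->
  EU f = k 1 - k 0.
Proof.
move=> hf fnd sec k0 k1.
(* [J] integrates over closed intervals, while [f] is controlled only inside; extending by zero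
   fixes the end values without changing the integral. *)
pose ft := f \_ I01.
have ftT : leb.-integrable setT (EFin \o ft).
  by rewrite -restrict_EFin; apply/integrable_restrict => //=; rewrite setTI.
have ftS (A : set (measurableTypeR R)) : measurable A ->
    leb.-integrable A (EFin \o ft).
  by move=> mA; apply: integrableS ftT.
pose J x := \int[leb]_(t in `[0, x]) ft t.
have J0 : J 0 = 0 by rewrite /J set_itv1 Rintegral_set1.
have J1 : J 1 = EU f.
  rewrite /J -Rintegral_itv_bndo_bndc; last exact: ftS.
  rewrite -Rintegral_itv_obnd_cbnd; last exact: ftS.
  by apply: EU_eq => u uI; rewrite /ft patchE uI.
have JB u v : 0 < u -> u < v -> v < 1 ->
    f u * (v - u) <= J v - J u <= f v * (v - u).
  move=> u0 uv v1.
  have -> : J v - J u = \int[leb]_(t in `]u, v]) ft t.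
    by rewrite /J Rintegral_itvB ?bnd_simp//; [exact: ftS|exact: ltW|exact: ltW].
  have cstE (c : R) : c * (v - u) = \int[leb]_(t in `]u, v]) c.
    rewrite Rintegral_cst//=; congr (_ * _).
    by rewrite lebesgue_measure_itv/= lte_fin uv.
  have icst (c : R) : leb.-integrable `]u, v] (EFin \o cst c).
    apply/integrableP; split; first exact/measurable_EFinP/measurable_cst.
    rewrite (eq_integral (cst `|c|%:E))// integral_cst//=.
    by rewrite lebesgue_measure_itv/= lte_fin uv -EFinD -EFinM ltry.
  have ftE t : u < t -> t <= v -> ft t = f t.
    move=> ut tv; rewrite /ft patchE mem_set//= in_itv/=.
    by rewrite (lt_trans u0)//= (le_lt_trans tv).
  rewrite !cstE; apply/andP; split; apply: le_Rintegral => //;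
    do ?[exact: icst|exact: ftS];
    move=> t /=; rewrite in_itv/= => /andP[ut tv]; rewrite ftE//; apply: fnd;
    by [|exact: ltW|exact: le_lt_trans v1|exact: lt_trans ut].
pose Phi x := J x - k x.
have PhiE a b : 0 < a -> a <= b -> b < 1 -> Phi a = Phi b.
  apply: (@increments_eq_of_secants f) => u v u0.
  rewrite le_eqVlt => /predU1P[<- _|uv v1].
    by rewrite !subrr normr0 mul0r.
  have /andP[? ?] := sec _ _ u0 uv v1; have /andP[? ?] := JB _ _ u0 uv v1.
  by rewrite /Phi ler_norml; apply/andP; split; lra.
have /(continuous_within_itvP _ (@ltr01 R))[_ cJ0 cJ1] :=
  parameterized_integral_continuous (@ler01 R) (ftS _ (measurable_itv `[0, 1])).
have c0 : Phi x @[x --> 0^'+] --> Phi 0 by apply: cvgB.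
have c1 : Phi x @[x --> 1^'-] --> Phi 1 by apply: cvgB.
have P0 : Phi 0 = Phi 2^-1.
  suff c : Phi x @[x --> 0^'+] --> Phi 2^-1 by exact: (cvg_unique _ c0 c).
  apply: cvg_near_cst.
  near=> x; apply: PhiE => //; last lra.
  near: x; apply: nbhs_right_le; lra.
have P1 : Phi 1 = Phi 2^-1.
  suff c : Phi x @[x --> 1^'-] --> Phi 2^-1 by exact: (cvg_unique _ c1 c).
  apply: cvg_near_cst.
  near=> x; apply/esym/PhiE => //.
  near: x; apply: nbhs_left_ge; lra.
by rewrite -J1; move: P1; rewrite -P0 /Phi J0; lra.
Unshelve. all: by end_near. Qed.

(* Integrate [(f u - EU f) * (k u - k u0) >= 0], where [u0] is the point at
   which [f - EU f] changes sign. *)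
Lemma covU_comonotone_ge0 f k : L2U f -> L2U k ->
  nondecreasing01 f -> nondecreasing01 k -> ~ qeq f (cst (EU f)) ->
  0 <= covU f k.
Proof.
move=> hf hk fnd knd ncst; set m := EU f in ncst *.
have hm := L2U_cst m.
have hfm : L2U (fun u => 1 * f u + (- 1) * cst m u) by exact: L2U_lin.
have Efm : EU (fun u => 1 * f u + (- 1) * cst m u) = 0.
  by rewrite (EU_lin _ _ (L2U_L1U hf) (L2U_L1U hm)) EU_cst /m; ring.
have {}ncst : ~ qeq (fun u => 1 * f u + (- 1) * cst m u) (cst 0).
  by move=> h; apply: ncst; apply: qeqS h => u _ /= h; lra.
(* As [f - m] has mean 0 and is not a.e. zero, it takes values of both kinds, so [sup A] lies
   strictly inside the unit interval, where [k] is monotone. *)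
pose A := [set u : R | 0 < u < 1 /\ f u <= m].
have [u1 Au1] : A !=set0.
  apply: contrapT => /forallNP A0; apply: ncst.
  apply: EU_eq0_ae => //; first exact: L2U_L1U.
  move=> u; rewrite inE/= in_itv/= => uI.
  have /negP : ~ (f u <= m) by move=> fu; apply: (A0 u).
  by rewrite -ltNge; lra.
have [u2 [u2I fu2]] : exists u, 0 < u < 1 /\ m < f u.
  apply: contrapT => /forallNP A0; apply: ncst.
  pose nf u := - 1 * (1 * f u + (- 1) * cst m u) + 0 * cst 0 u.
  have h0 := L2U_cst (0 : R).
  have : qeq nf (cst 0).
    apply: EU_eq0_ae => //.
    - exact: (L2U_L1U (L2U_lin (-1) 0 hfm h0)).
    - move=> u; rewrite inE/= in_itv/= /nf => uI.
      have /negP : ~ (m < f u) by move=> fu; apply: (A0 u).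
      by rewrite -leNgt /=; lra.
    - by rewrite (EU_lin _ _ (L2U_L1U hfm) (L2U_L1U h0)) Efm; ring.
  by apply: qeqS => u _; rewrite /nf /=; lra.
have ubA : ubound A u2.
  move=> u [/andP[u0 u1'] fu]; rewrite leNgt; apply/negP => u2u.
  by have := fnd u2 u; move: u2I => /andP[-> _] /(_ isT (ltW u2u) u1'); lra.
have supA : has_sup A by split; [exists u1|exists u2].
pose s := sup A.
have s0 : 0 < s.
  by have := ub_le_sup supA.2 Au1; case: Au1 => /andP[? _] _; exact: lt_le_trans.
have s1 : s < 1.
  have su2 : s <= u2 by apply: ge_sup => //; exists u1.
  by move: u2I => /andP[_]; exact: le_lt_trans.
have below u : 0 < u -> u < s -> f u <= m.
  move=> u0 us; have [v [/andP[v0 v1] fv] uv] := sup_gt (ex_intro _ _ Au1) us.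
  exact: le_trans (fnd _ _ u0 (ltW uv) v1) fv.
have above u : s < u -> u < 1 -> m <= f u.
  move=> su u1'; rewrite leNgt; apply/negP => fu.
  have : u <= s.
    by apply: (ub_le_sup supA.2); split; [rewrite (lt_trans s0)|exact: ltW].
  by rewrite leNgt su.
(* Constants can be subtracted inside a covariance, and the product of means vanishes because
   [f - m] has mean 0. *)
have -> : covU f k =
    EU (fun u => (1 * f u + - 1 * cst m u) * (1 * k u + (- k s) * cst 1 u)).
  have hc := L2U_cst (1 : R).
  have -> : covU f k = covU (fun u => 1 * f u + - 1 * cst m u)
                            (fun u => 1 * k u + (- k s) * cst 1 u).
    rewrite covU_linl//; last exact: L2U_lin.
    rewrite (covU_cstl _ (L2U_L1U (L2U_lin 1 (- k s) hk hc))) covU_linr//.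
    by rewrite (covUC f (cst 1)) (covU_cstl _ (L2U_L1U hf)); ring.
  by rewrite /covU Efm mul0r subr0.
apply: EU_ge0 => u; rewrite inE/= in_itv/= => /andP[u0 u1'].
have [us|su|->] := ltgtP u s; last by rewrite /=; nra.
- have := below _ u0 us; have := knd _ _ u0 (ltW us) s1; rewrite /=; nra.
- have := above _ su u1'; have := knd _ _ s0 (ltW su) u1'; rewrite /=; nra.
Qed.

End monotone_on_unit_interval.

(** * Left derivatives of a concave distortion *)

Section concave_distortion.
Variables (R : realType) (g : R -> R).
Hypotheses (dg : distortion g) (cg : concave_on01 g).
Local Notation leb := (@lebesgue_measure R).
Local Notation I01 := (`]0, 1[%classic : set (measurableTypeR R)).

(** Concavity cleared of denominators, so that slope comparisons can be left to [lra]. *)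
Lemma concave_three_points a b c : 0 <= a -> a <= b -> b <= c -> c <= 1 ->
  a < c -> (c - b) * g a + (b - a) * g c <= (c - a) * g b.
Proof.
move=> a0 ab bc c1 ac.
have ca : 0 < c - a by lra.
have ca0 : c - a != 0 by rewrite gt_eqF.
have := @cg a c ((c - b) / (c - a)).
rewrite !in_itv/= => /(_ ltac:(lra) ltac:(lra)).
have t01 : 0 <= (c - b) / (c - a) <= 1.
  by rewrite divr_ge0/=; [rewrite ler_pdivrMr//; lra|lra|lra].
move=> /(_ t01).
have -> : (c - b) / (c - a) * a + (1 - (c - b) / (c - a)) * c = b by field.
move=> /(ler_wpM2l (ltW ca)); congr (_ <= _); by field.
Qed.

Definition left_slope x h := (g x - g (x - h)) / h.

Lemma left_slope_ge x h t : 0 < h -> h <= x -> x < t -> t <= 1 ->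
  (g t - g x) / (t - x) <= left_slope x h.
Proof.
move=> h0 hx xt t1; rewrite /left_slope ler_pdivrMr; last lra.
rewrite mulrAC ler_pdivlMr//.
have := @concave_three_points (x - h) x t; move=> /(_ ltac:(lra) ltac:(lra)).
by move=> /(_ ltac:(lra) t1 ltac:(lra)); lra.
Qed.

Lemma left_slope_nondecreasing x h h' : 0 < h -> h <= h' -> h' <= x -> x <= 1 ->
  left_slope x h <= left_slope x h'.
Proof.
move=> h0 hh hx x1; rewrite /left_slope ler_pdivrMr// mulrAC ler_pdivlMr; last lra.
have := @concave_three_points (x - h') (x - h) x; move=> /(_ ltac:(lra) ltac:(lra)).
by move=> /(_ ltac:(lra) x1 ltac:(lra)); lra.
Qed.

Lemma left_slope_lbound x : 0 < x < 1 ->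
  has_lbound (left_slope x @` `]0, x[).
Proof.
move=> /andP[x0 x1]; exists ((g 1 - g x) / (1 - x)) => _ /= [h + <-].
by rewrite in_itv/= => /andP[h0 hx]; apply: left_slope_ge => //; exact: ltW.
Qed.

(** By concavity the slopes decrease as the step shrinks and stay above the secant to 1; hence the
    [lim] in [left_deriv] is a genuine limit. *)
Lemma left_derivE x : 0 < x < 1 ->
  left_deriv g x = inf (left_slope x @` `]0, x[).
Proof.
move=> /[dup] xI /andP[x0 x1]; apply: cvg_lim => //.
apply: (@nondecreasing_at_right_cvgr _ _ _ (BLeft x)); rewrite ?bnd_simp//.
  move=> h h'; rewrite !in_itv/= => /andP[h0 hx] /andP[h'0 h'x] hh.
  by apply: left_slope_nondecreasing => //; exact: ltW.
exact: left_slope_lbound.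
Qed.

Lemma left_deriv_le x s : 0 < s -> s < x -> x < 1 ->
  left_deriv g x * (x - s) <= g x - g s.
Proof.
move=> s0 sx x1; have xI : 0 < x < 1 by lra.
rewrite -ler_pdivlMr; last lra.
rewrite left_derivE//; apply: ge_inf; first exact: left_slope_lbound.
exists (x - s); first by rewrite /= in_itv/=; lra.
by rewrite /left_slope; congr ((_ - g _) / _); lra.
Qed.

Lemma left_deriv_ge x t : 0 < x -> x < t -> t <= 1 ->
  g t - g x <= left_deriv g x * (t - x).
Proof.
move=> x0 xt t1; rewrite -ler_pdivrMr; last lra.
rewrite left_derivE; last lra.
apply: lb_le_inf.
  by exists (left_slope x (x / 2)), (x / 2) => //=; rewrite in_itv/=; lra.
move=> _ [h + <-]; rewrite /= in_itv/= => /andP[h0 hx].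
by apply: left_slope_ge => //; exact: ltW.
Qed.

(** This sandwich yields both the monotonicity of [gammaD g] and, through [EU_of_secants] with
    [k u = - g (1 - u)], its integral. *)
Lemma gammaD_secants u v : 0 < u -> u < v -> v < 1 ->
  gammaD g u * (v - u) <= g (1 - u) - g (1 - v) <= gammaD g v * (v - u).
Proof.
move=> u0 uv v1; rewrite /gammaD.
have := @left_deriv_le (1 - u) (1 - v) ltac:(lra) ltac:(lra) ltac:(lra).
have := @left_deriv_ge (1 - v) (1 - u) ltac:(lra) ltac:(lra) ltac:(lra).
have -> : 1 - u - (1 - v) = v - u by ring.
by move=> -> ->.
Qed.

Lemma gammaD_nondecreasing : nondecreasing01 (gammaD g).
Proof.
move=> u v u0; rewrite le_eqVlt => /predU1P[->//|uv v1].
have /andP[h1 h2] := gammaD_secants u0 uv v1.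
by have := le_trans h1 h2; rewrite ler_pM2r//; lra.
Qed.

Hypothesis hA1 : A1 g.

Lemma L2U_gammaD : L2U (gammaD g).
Proof.
split; last by have [] := hA1.
by apply: nondecreasing01_measurable; exact: gammaD_nondecreasing.
Qed.

Lemma abs_continuous01_uniform e : 0 < e -> exists2 d : R, 0 < d &
  forall a b, 0 <= a -> a <= b -> b <= 1 -> b - a < d -> `|g b - g a| < e.
Proof.
have [ac _] := hA1 => /ac[d d0 H]; exists d => // a b a0 ab b1 bad.
have := H 1%N (fun=> a) (fun=> b); rewrite !big_ord1; apply => //.
by move=> i j; rewrite !ord1.
Qed.

(** Concavity controls [g] inside the interval; absolute continuity gives continuity at the two
    ends. A jump of [g] at 0 would be lost by the integral. *)
Lemma EU_gammaD : EU (gammaD g) = 1.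
Proof.
rewrite (@EU_of_secants _ _ (fun u => - g (1 - u))).
- by have [_ [_ [g0 g1]]] := dg; rewrite subrr subr0 g0 g1; lra.
- exact: L2U_L1U L2U_gammaD.
- exact: gammaD_nondecreasing.
- move=> u v u0 uv v1; have /andP[? ?] := gammaD_secants u0 uv v1.
  by apply/andP; split; lra.
- apply/cvgrPdist_lt => e /abs_continuous01_uniform[d d0 H]; near=> x.
  have x0 : 0 < x by [].
  have xd : x < d by near: x; exact: nbhs_right_lt.
  have x1 : x < 1 by near: x; exact: nbhs_right_lt.
  by rewrite -opprD normrN; apply: H; lra.
- apply/cvgrPdist_lt => e /abs_continuous01_uniform[d d0 H]; near=> x.
  have x1 : x < 1 by [].
  have xd : 1 - d < x by near: x; apply: nbhs_left_gt; lra.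
  have x0 : 0 < x by near: x; exact: nbhs_left_gt.
  by rewrite -opprD normrN distrC; apply: H; lra.
Unshelve. all: by end_near. Qed.

End concave_distortion.

(** * Laws and quantile functions *)

Section laws.
Variable R : realType.
Local Notation leb := (@lebesgue_measure R).
Local Notation I01 := (`]0, 1[%classic : set (measurableTypeR R)).
Local Notation U01 := (uniform_prob (@ltr01 R)).
Implicit Types (f : R -> R) (G : probability R R).

(** Quantifying over all measurable [phi], integrable or not, lets one statement transfer both the
    finiteness and the values of moments. *)
Definition has_law f G := forall phi : R -> \bar R, measurable_fun setT phi ->
  (\int[G]_y phi y = \int[leb]_(u in I01) phi (f u))%E.

Lemma has_law_ge0 f G :
  (forall phi : R -> \bar R, measurable_fun setT phi -> (forall y, 0 <= phi y)%E ->
    (\int[G]_y phi y = \int[leb]_(u in I01) phi (f u))%E) -> has_law f G.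
Proof.
move=> H phi mphi; rewrite integralE [in RHS]integralE.
rewrite (H _ (measurable_funepos mphi))// (H _ (measurable_funeneg mphi))//.
by congr (_ - _)%E; apply: eq_integral => u _; rewrite ?funeposE ?funenegE.
Qed.

(** A random variable must be measurable on the whole line; the values outside the unit interval
    carry no mass under [U01]. *)
Definition zero_ext f := f \_ I01.

Lemma measurable_zero_ext f : measurable_fun I01 f ->
  measurable_fun [set: measurableTypeR R] (zero_ext f).
Proof. by move=> mf; apply/measurable_restrict => //; rewrite setTI. Qed.

Definition zero_ext_mfun f (mf : measurable_fun I01 f) :
    {mfun measurableTypeR R >-> R} :=
  mfun_Sub (mem_set (measurable_zero_ext mf)).

Definition law f (mf : measurable_fun I01 f) : probability R R :=
  distribution U01 (zero_ext_mfun mf).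

Lemma integral_U01 (phi : measurableTypeR R -> \bar R) :
  measurable_fun setT phi -> (forall u, 0 <= phi u)%E ->
  (\int[U01]_u phi u = \int[leb]_(u in I01) phi u)%E.
Proof.
move=> mphi phi0; rewrite integral_uniform// subr0 invr1 mul1e.
rewrite -integral_itv_bndo_bndc; last exact: measurable_funTS.
by rewrite -integral_itv_obnd_cbnd//; exact: measurable_funTS.
Qed.

Lemma law_has_law f (mf : measurable_fun I01 f) : has_law f (law mf).
Proof.
apply: has_law_ge0 => // phi mphi phi0.
rewrite ge0_integral_distribution// integral_U01//; last 2 first.
- by apply: measurableT_comp.
- by move=> u; exact: phi0.
by apply: eq_integral => u uI /=; rewrite /zero_ext patchE uI.
Qed.

Lemma has_law_measure f G (A : set R) : measurable A -> measurable_fun I01 f ->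
  has_law f G -> G A = leb (I01 `&` f @^-1` A).
Proof.
move=> mA mf fG; have := fG (EFin \o \1_A).
rewrite integral_indic// setIT => ->; last first.
  exact/measurable_EFinP/measurable_indic.
have mfA : measurable (I01 `&` f @^-1` A) by exact: mf.
transitivity (\int[leb]_(u in I01) (\1_(I01 `&` f @^-1` A) u)%:E)%E.
  by apply: eq_integral => u uI /=; rewrite !indicE in_setI uI.
by rewrite integral_indic// setIC setIA setIid.
Qed.

Lemma has_law_M2 f G : measurable_fun I01 f -> has_law f G -> M2 G <-> L2U f.
Proof.
move=> mf fG.
have E : (\int[G]_y `|(y ^+ 2)%:E| = \int[leb]_(u in I01) `|(f u ^+ 2)%:E|)%E.
  apply: (fG (fun y => `|(y ^+ 2)%:E|%E)); apply: measurableT_comp => //.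
  exact/measurable_EFinP/measurable_funX.
split=> [/integrableP[_ h]|[_ /integrableP[_ h]]].
- split=> //; apply/integrableP; split; first exact/measurable_EFinP/measurable_funX.
  by rewrite -E.
- apply/integrableP; split; last by rewrite E.
  by apply/measurable_EFinP; exact: measurable_funX.
Qed.

Lemma has_law_mom1 f G : has_law f G -> mom1 G = EU f.
Proof. by move=> fG; congr fine; apply: (fG EFin). Qed.

Lemma has_law_mom2 f G : has_law f G -> mom2 G = EU (fun u => f u ^+ 2).
Proof.
move=> fG; congr fine; apply: (fG (fun y => (y ^+ 2)%:E)).
by apply/measurable_EFinP; exact: measurable_funX.
Qed.

End laws.

(** * Quantile functions *)

Section quantile.
Variables (R : realType) (G : probability R R).
Local Notation leb := (@lebesgue_measure R).
Local Notation I01 := (`]0, 1[%classic : set (measurableTypeR R)).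

Let idR : {mfun R >-> R} := mfun_Sub (mem_set (@measurable_id _ R setT)).

Let cdfE x : (Defs.cdf G x)%:E = random_variable.cdf (P := G) idR x.
Proof.
by rewrite /Defs.cdf fineK ?fin_num_measure// -set_itvNyc.
Qed.

Lemma cdf_le x y : x <= y -> Defs.cdf G x <= Defs.cdf G y.
Proof. by move=> xy; rewrite -lee_fin !cdfE; exact: cdf_nondecreasing. Qed.

Lemma cdf_ge0 x : 0 <= Defs.cdf G x.
Proof. by rewrite -lee_fin cdfE random_variable.cdf_ge0. Qed.

Lemma cdf_le1 x : Defs.cdf G x <= 1.
Proof. by rewrite -lee_fin cdfE random_variable.cdf_le1. Qed.

Lemma cdf_gt_ex u : u < 1 -> exists y, u <= Defs.cdf G y.
Proof.
move=> u1; apply: contrapT => /forallNP H.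
have c1 := cvg_cdfy1 (P := G) idR.
suff : (1 <= u%:E :> \bar R)%E by rewrite lee_fin leNgt u1.
rewrite -(cvg_lim _ c1)//; apply: lime_le; first exact: cvgP c1.
by near=> y; rewrite -cdfE lee_fin ltW// ltNge; apply/negP.
Unshelve. all: by end_near. Qed.

Lemma cdf_lt_ex u : 0 < u -> exists y, Defs.cdf G y < u.
Proof.
move=> u0; apply: contrapT => /forallNP H.
have c0 := cvg_cdfNy0 (P := G) idR.
suff : (u%:E <= 0 :> \bar R)%E by rewrite lee_fin leNgt u0.
rewrite -(cvg_lim _ c0)//; apply: lime_ge; first exact: cvgP c0.
by near=> y; rewrite -cdfE lee_fin leNgt; apply/negP.
Unshelve. all: by end_near. Qed.

(** Right-continuity of the distribution function puts the infimum in its set. The bounds on [u]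
    make that set nonempty and bounded below, so [inf] is not a default value. *)
Lemma quantile_leP u x : 0 < u < 1 -> quantile G u <= x <-> u <= Defs.cdf G x.
Proof.
move=> /andP[u0 u1].
have [y0 Sy0] := cdf_gt_ex u1; have [y1 y1u] := cdf_lt_ex u0.
have lb : has_lbound [set y : R | u <= Defs.cdf G y].
  exists y1 => y /= uy; rewrite leNgt; apply/negP => yy1.
  by have := cdf_le (ltW yy1); rewrite leNgt (lt_le_trans y1u uy).
split=> [qx|ux]; last exact: ge_inf.
have above y : x < y -> u <= Defs.cdf G y.
  move=> xy; have [z /= uz zy] := inf_lt (ex_intro _ y0 Sy0) (le_lt_trans qx xy).
  exact: le_trans uz (cdf_le (ltW zy)).
rewrite -lee_fin cdfE.
have cx := @cdf_right_continuous _ _ _ G idR x.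
rewrite -(cvg_lim _ cx)//; apply: lime_ge; first exact: cvgP cx.
near=> y; rewrite -cdfE lee_fin; apply: above; near: y; exact: nbhs_right_gt.
Unshelve. all: by end_near. Qed.

Lemma quantile_nondecreasing : nondecreasing01 (quantile G).
Proof.
move=> u v u0 uv v1; have vI : 0 < v < 1 by lra.
apply/quantile_leP; first lra.
by apply: le_trans uv _; apply/(quantile_leP _ vI).
Qed.

Lemma measurable_quantile : measurable_fun I01 (quantile G).
Proof. by apply: nondecreasing01_measurable; exact: quantile_nondecreasing. Qed.

Let lawq := law measurable_quantile.

Lemma quantile_law_itv (x : R) : lawq `]-oo, x]%classic = G `]-oo, x]%classic.
Proof.
rewrite (has_law_measure _ measurable_quantile (law_has_law _))//.
set c := Defs.cdf G x.
have cG : G `]-oo, x]%classic = c%:E.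
  by rewrite /c /Defs.cdf fineK ?fin_num_measure// -set_itvNyc.
rewrite cG.
have -> : I01 `&` quantile G @^-1` `]-oo, x] = I01 `&` [set u | u <= c].
  apply/seteqP; split=> u /=; rewrite !in_itv/= => -[uI h]; split=> //.
    by apply/quantile_leP.
  by apply/quantile_leP.
(* Since the unit interval is open at 1, the set is []0, c]] for [c < 1] but the whole interval for
   [c = 1]. *)
have [c1|c1] := ltP c 1.
  have -> : I01 `&` [set u | u <= c] = `]0, c]%classic.
    apply/seteqP; split=> u /=; rewrite !in_itv/=; first by move=> [/andP[-> _] ->].
    by move=> /andP[-> uc]; rewrite (le_lt_trans uc c1).
  have c0 : 0 <= c := cdf_ge0 x.
  rewrite lebesgue_measure_itv/= lte_fin; case: ltgtP c0 => // [_|<-] _ //.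
  by rewrite sube0.
have -> : I01 `&` [set u | u <= c] = I01.
  apply/seteqP; split=> u /=; rewrite !in_itv/=; first by case.
  by move=> /andP[-> u1]; rewrite u1; split=> //; exact: le_trans (ltW u1) c1.
by rewrite lebesgue_measure01; congr (_%:E); apply/eqP; rewrite eq_le c1 cdf_le1.
Qed.

(** Half-open intervals form a pi-system generating the Borel sets, so agreement on half-lines
    determines the law. *)
Lemma quantile_has_law : has_law (quantile G) G.
Proof.
move=> phi mphi; rewrite -(law_has_law measurable_quantile)//.
apply: eq_measure_integral => A mA _.
apply: (@measure_unique _ R R (@ocitv R) (fun n => `]- n%:R, n%:R]%classic)) => //.
- exact: ocitvI.
- by move=> n; exact: is_ocitv.
- rewrite -subTset => y _; exists (Num.truncn `|y|).+1 => //=.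
  have := truncnS_gt `|y|; rewrite in_itv/= => h.
  rewrite (le_trans (ler_norm _) (ltW h)) andbT ltrNl.
  by rewrite (le_lt_trans _ h)// -normrN ler_norm.
- move=> _ [[a b] _ <-].
  have -> : `](a, b).1, (a, b).2]%classic = `]-oo, b] `\` `]-oo, a] :> set R.
    by rewrite -[RHS]setCK setCD setCitvl setUC -[LHS]setCK setCitv.
  have [ab|ba] := leP a b; last first.
    have -> : `]-oo, b]%classic `\` `]-oo, a]%classic = set0 :> set R.
      by rewrite setD_eq0; apply: subset_itvl; rewrite bnd_simp ltW.
    by rewrite !measure0.
  have PB (P : probability R R) : P (`]-oo, b] `\` `]-oo, a]) =
      (P `]-oo, b]%classic - P `]-oo, a]%classic)%E.
    rewrite measureD//; last by rewrite -ge0_fin_numE// fin_num_measure.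
    by rewrite setIidr//; apply: subset_itvl.
  apply: etrans (PB G) _; apply: etrans (esym (PB lawq)).
  by rewrite !quantile_law_itv.
- by move=> n; rewrite -ge0_fin_numE// fin_num_measure.
Qed.

End quantile.

(** Take the law of [f (U)]. Every [v <= u] has [f v <= f u], so its distribution function is at
    least [u] at [f u], whence [quantile G <= f] pointwise; equal means then force equality a.e. *)
Lemma ex_law_quantile (R : realType) (f : R -> R) : L2U f -> nondecreasing01 f ->
  exists G : probability R R, [/\ M2 G, mom1 G = EU f,
    mom2 G = EU (fun u => f u ^+ 2) & qeq (quantile G) f].
Proof.
move=> hf fnd; pose G := law hf.1; exists G.
have fG := law_has_law hf.1 : has_law f G.
have m2 : M2 G by apply/(has_law_M2 hf.1 fG).
split=> //; [exact: has_law_mom1|exact: has_law_mom2|].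
have mq := measurable_quantile G; have qG := quantile_has_law G.
have hq : L2U (quantile G) by apply/(has_law_M2 mq qG).
suff : qeq (fun u => 1 * f u + - 1 * quantile G u) (cst 0).
  by apply: qeqS => u _ /=; lra.
apply: EU_eq0_ae.
- exact: L2U_L1U (L2U_lin _ _ hf hq).
- move=> u; rewrite inE/= in_itv/= => uI.
  suff : quantile G u <= f u by lra.
  apply/quantile_leP => //.
  rewrite /Defs.cdf -set_itvNyc (has_law_measure _ hf.1 fG)//.
  have [u0 u1] := andP uI.
  set S := (X in lebesgue_measure X).
  have mS : measurable (S : set (measurableTypeR R)) by apply: hf.1.
  have uE : lebesgue_measure (`]0, u]%classic : set (measurableTypeR R)) = u%:E.
    by rewrite lebesgue_measure_itv/= lte_fin u0 sube0.
  have Sfin : lebesgue_measure S \is a fin_num.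
    rewrite ge0_fin_numE// (@le_lt_trans _ _ 1%E) ?ltry//.
    rewrite -lebesgue_measure01; apply: le_measure; rewrite ?inE//.
    exact: subIsetl.
  rewrite -lee_fin fineK// -uE; apply: le_measure; rewrite ?inE//.
  move=> v /=; rewrite !in_itv/= => /andP[v0 vu].
  by rewrite /S /= !in_itv/= v0 (le_lt_trans vu u1); split=> //; exact: fnd.
- rewrite (EU_lin _ _ (L2U_L1U hf) (L2U_L1U hq)).
  by rewrite -(has_law_mom1 fG) -(has_law_mom1 qG); ring.
Qed.

(** * Standardisation and the multiplier *)

Section standardization.
Variable R : realType.
Local Notation leb := (@lebesgue_measure R).
Local Notation I01 := (`]0, 1[%classic : set (measurableTypeR R)).
Implicit Types (f k w q : R -> R) (m s : R).

Lemma EU_ae f k : L1U f -> L1U k -> qeq f k -> EU f = EU k.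
Proof.
move=> hf hk fk; congr fine; apply: ae_eq_integral => //.
- exact: measurable_int hf.
- exact: measurable_int hk.
apply: (@filterS _ _ (ae_filter_ringOfSetsType leb)) fk => u h uI /=.
by rewrite h.
Qed.

Lemma covU_ae f k1 k2 : L2U f -> L2U k1 -> L2U k2 -> qeq k1 k2 ->
  covU f k1 = covU f k2.
Proof.
move=> hf h1 h2 k12; rewrite /covU (EU_ae (L2U_L1U h1) (L2U_L1U h2))//.
congr (_ - _); apply: EU_ae; [exact: L2U_mul|exact: L2U_mul|].
by apply: qeqS k12 => u _ ->.
Qed.

Lemma varU_eq0_ae f : L2U f -> varU f = 0 -> qeq f (cst (EU f)).
Proof.
move=> hf V0; have hc := L2U_cst (EU f).
have E0 := EU_sqr_sub hf hc.
rewrite EU_cst subrr expr0n/= addr0 V0 (covUC f) /varU in E0.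
rewrite !covU_cstl in E0; [|exact: L1U_cst|exact: L2U_L1U].
have hd := L2U_lin 1 (-1) hf hc.
have : qeq (fun u => 1 * f u + -1 * cst (EU f) u) (cst 0).
  apply: EU_sqr_eq0_ae hd _; rewrite -[RHS](_ : 0 - 2 * 0 + 0 = 0); last by ring.
  by rewrite -E0; apply: EU_eq => u _ /=; congr (_ ^+ 2); ring.
by apply: qeqS => u _ /=; lra.
Qed.

Definition standardize m s w u := m + s * ((w u - EU w) / stdU w).

Variable w : R -> R.
Hypotheses (hw : L2U w) (Vw : 0 < varU w).

Lemma stdU_gt0 : 0 < stdU w. Proof. by rewrite sqrtr_gt0. Qed.

Lemma sqr_stdU : stdU w ^+ 2 = varU w. Proof. by rewrite sqr_sqrtr// ltW. Qed.

Lemma standardizeE m s : standardize m s w =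
  fun u => s / stdU w * w u + (m - s * EU w / stdU w) * cst 1 u.
Proof.
have b0 := gt_eqF stdU_gt0.
by apply/funext => u; rewrite /standardize /=; field; rewrite b0.
Qed.

Lemma L2U_standardize m s : L2U (standardize m s w).
Proof. by rewrite standardizeE; apply: L2U_lin => //; exact: L2U_cst. Qed.

Lemma EU_standardize m s : EU (standardize m s w) = m.
Proof.
have b0 := gt_eqF stdU_gt0.
rewrite standardizeE EU_lin; [|exact: L2U_L1U|exact: L1U_cst].
by rewrite EU_cst; field; rewrite b0.
Qed.

Lemma covU_standardize m s f : L2U f ->
  covU f (standardize m s w) = s / stdU w * covU f w.
Proof.
move=> hf; rewrite standardizeE covU_linr//; last exact: L2U_cst.
by rewrite (covUC f (cst 1)) covU_cstl ?mulr0 ?addr0//; exact: L2U_L1U.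
Qed.

Lemma covU_standardize_self m s : covU w (standardize m s w) = s * stdU w.
Proof.
have b0 := gt_eqF stdU_gt0.
by rewrite covU_standardize// -/(varU w) -sqr_stdU; field; rewrite b0.
Qed.

Lemma varU_standardize m s : varU (standardize m s w) = s ^+ 2.
Proof.
have b0 := gt_eqF stdU_gt0.
rewrite /varU covU_standardize; last exact: L2U_standardize.
by rewrite covUC covU_standardize_self; field; rewrite b0.
Qed.

(** For [s > 0] the defect in Cauchy-Schwarz is a positive multiple of the squared distance to the
    standardised [w]. The inequality and its equality case follow at once, hence optimality and
    uniqueness. *)
Lemma EU_sqr_sub_standardize q s : L2U q -> varU q = s ^+ 2 ->
  EU (fun u => (q u - standardize (EU q) s w u) ^+ 2) =
  2 * s / stdU w * (s * stdU w - covU w q).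
Proof.
move=> hq Vq; have b0 := gt_eqF stdU_gt0.
rewrite (EU_sqr_sub hq (L2U_standardize _ _)) EU_standardize varU_standardize.
by rewrite covU_standardize// Vq (covUC q); field; rewrite b0.
Qed.

Lemma covU_le_std q s : L2U q -> 0 < s -> varU q = s ^+ 2 ->
  covU w q <= s * stdU w.
Proof.
move=> hq s0 Vq.
have : 0 <= EU (fun u => (q u - standardize (EU q) s w u) ^+ 2).
  by apply: EU_ge0 => u _; exact: sqr_ge0.
rewrite EU_sqr_sub_standardize// pmulr_rge0 ?subr_ge0//.
by rewrite divr_gt0 ?mulr_gt0// stdU_gt0.
Qed.

Lemma covU_eq_std q s : L2U q -> 0 < s -> varU q = s ^+ 2 ->
  s * stdU w <= covU w q -> qeq q (standardize (EU q) s w).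
Proof.
move=> hq s0 Vq le; have hh := L2U_standardize (EU q) s.
have E0 := EU_sqr_sub_standardize hq Vq.
have {le} e : covU w q = s * stdU w.
  by apply/eqP; rewrite eq_le le (covU_le_std hq s0 Vq).
rewrite e subrr mulr0 in E0.
have hd := L2U_lin 1 (-1) hq hh.
have : qeq (fun u => 1 * q u + -1 * standardize (EU q) s w u) (cst 0).
  apply: EU_sqr_eq0_ae hd _; rewrite -E0.
  by apply: EU_eq => u _; congr (_ ^+ 2); ring.
by apply: qeqS => u _ /=; lra.
Qed.

End standardization.

(* In the notation of the theorem, [X = C + l sF^2] satisfies
   [sF^2 b_l^2 = X^2 + (V sF^2 - C^2)], so [sigma X / b_l = K] is a quadratic
   equation in [X] with positive root [K rt]. *)
Section multiplier.
Variables (R : realType) (V C s sigma K : R).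
Hypotheses (V0 : 0 < V) (C0 : 0 <= C) (s0 : 0 < s) (sig0 : 0 < sigma).
(** [KC] says that [h_0] violates the constraint [cov (F^-1, q) >= K]; [Ks] says that [K] is
    strictly below the largest covariance allowed by Cauchy-Schwarz. *)
Hypotheses (KC : sigma * C < K * Num.sqrt V) (Ks : K < sigma * s).

(** This is [b_lambda / sigma] at the solution, see [multiplier_sqrt_W]. Numerator and denominator
    are both negative. *)
Definition multiplier_root : R :=
  Num.sqrt ((C ^+ 2 - V * s ^+ 2) / (K ^+ 2 - sigma ^+ 2 * s ^+ 2)).
Definition multiplier : R := K / s ^+ 2 * multiplier_root - C / s ^+ 2.

Local Notation rt := multiplier_root.
Local Notation lam := multiplier.
Local Notation W l := (V + 2 * l * C + l ^+ 2 * s ^+ 2).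

Let v := Num.sqrt V.
Let v0 : 0 < v. Proof. by rewrite sqrtr_gt0. Qed.
Let vE : V = v ^+ 2. Proof. by rewrite sqr_sqrtr// ltW. Qed.

Lemma multiplier_K_gt0 : 0 < K.
Proof.
by rewrite -(pmulr_lgt0 _ v0); apply: le_lt_trans KC; rewrite mulr_ge0// ltW.
Qed.
Let K0 := multiplier_K_gt0.

Let T0 : 0 < sigma ^+ 2 * s ^+ 2 - K ^+ 2.
Proof.
rewrite -exprMn subr_sqr; apply: mulr_gt0; first by rewrite subr_gt0.
by rewrite addr_gt0// mulr_gt0.
Qed.

Let CV : sigma ^+ 2 * C ^+ 2 < K ^+ 2 * V.
Proof.
rewrite vE -!exprMn ltr_pXn2r// ?nnegrE; first exact: mulr_ge0 (ltW _) _.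
by rewrite mulr_ge0// ltW.
Qed.

(** Chain the two bounds: [sigma^2 C^2 < K^2 V <= sigma^2 s^2 V]. *)
Let Delta0 : 0 < V * s ^+ 2 - C ^+ 2.
Proof.
rewrite -(pmulr_rgt0 _ (exprn_gt0 2 sig0)) mulrBr subr_gt0.
apply: lt_le_trans CV _.
rewrite [X in _ <= X](_ : _ = sigma ^+ 2 * s ^+ 2 * V); last ring.
by apply: ler_wpM2r; [exact: ltW|rewrite -subr_ge0 ltW].
Qed.

Lemma multiplier_root_opp :
  rt = Num.sqrt ((V * s ^+ 2 - C ^+ 2) / (sigma ^+ 2 * s ^+ 2 - K ^+ 2)).
Proof. by rewrite /rt -(opprB (V * _)) -(opprB _ (K ^+ 2)) invrN mulrNN. Qed.

Lemma multiplier_rootE :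
  rt ^+ 2 * (sigma ^+ 2 * s ^+ 2 - K ^+ 2) = V * s ^+ 2 - C ^+ 2.
Proof.
rewrite multiplier_root_opp sqr_sqrtr; last by rewrite divr_ge0// ltW.
by rewrite divfK// gt_eqF.
Qed.

Lemma multiplier_root_gt0 : 0 < rt.
Proof. by rewrite multiplier_root_opp sqrtr_gt0 divr_gt0. Qed.
Let rt0 := multiplier_root_gt0.

Lemma multiplierE : C + lam * s ^+ 2 = K * rt.
Proof. by rewrite /lam; field; rewrite gt_eqF. Qed.

Lemma multiplier_gt0 : 0 < lam.
Proof.
have s20 : 0 < s ^+ 2 by rewrite exprn_gt0.
rewrite -(pmulr_lgt0 _ s20) -(ltrD2l C) addr0 multiplierE.
rewrite -(@ltr_pXn2r _ 2)// ?nnegrE; last by rewrite mulr_ge0// ltW.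
rewrite exprMn -(ltr_pM2r T0) -[X in _ < X]mulrA multiplier_rootE.
(* After squaring [C < K * rt] and clearing the denominator, the terms [K^2 C^2] cancel and [CV]
   remains. *)
have : sigma ^+ 2 * C ^+ 2 * s ^+ 2 < K ^+ 2 * V * s ^+ 2 by rewrite ltr_pM2r.
by rewrite -subr_gt0 => h; rewrite -subr_gt0; lra.
Qed.

Lemma multiplier_W : W lam = (sigma * rt) ^+ 2.
Proof.
have s20 : s ^+ 2 != 0 by rewrite gt_eqF// exprn_gt0.
apply: (mulIf s20).
have -> : W lam * s ^+ 2 = (C + lam * s ^+ 2) ^+ 2 + (V * s ^+ 2 - C ^+ 2) by ring.
by rewrite multiplierE -multiplier_rootE; ring.
Qed.

Lemma multiplier_sqrt_W : Num.sqrt (W lam) = sigma * rt.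
Proof. by rewrite multiplier_W sqrtr_sqr ger0_norm// mulr_ge0// ltW. Qed.

Lemma multiplier_sol : sigma / Num.sqrt (W lam) * (C + lam * s ^+ 2) = K.
Proof. by rewrite multiplier_sqrt_W multiplierE; field; rewrite !gt_eqF. Qed.

Lemma multiplier_uniq l : 0 < l ->
  sigma / Num.sqrt (W l) * (C + l * s ^+ 2) = K -> l = lam.
Proof.
move=> l0; have s20 : 0 < s ^+ 2 by rewrite exprn_gt0.
have W0 : 0 < W l.
  by rewrite -addrA ltr_wpDr// addr_ge0// ?mulr_ge0// ?exprn_ge0// ltW.
set b := Num.sqrt _; have b0 : 0 < b by rewrite sqrtr_gt0.
have bE : b ^+ 2 = W l by rewrite sqr_sqrtr// ltW.
set X := C + l * s ^+ 2 => eK.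
(* Squaring the equation would also admit [X = - K * rt]; the sign of [X], which rests on [C >= 0],
   excludes it. *)
have X0 : 0 <= X by rewrite addr_ge0// mulr_ge0// ltW.
have {}eK : sigma * X = K * b by rewrite -eK; field; rewrite gt_eqF.
have X2 : X ^+ 2 = (K * rt) ^+ 2.
  apply: (mulIf (lt0r_neq0 T0)).
  have -> : (K * rt) ^+ 2 * (sigma ^+ 2 * s ^+ 2 - K ^+ 2) =
    K ^+ 2 * (V * s ^+ 2 - C ^+ 2) by rewrite -multiplier_rootE; ring.
  have : (sigma * X) ^+ 2 * s ^+ 2 = (K * b) ^+ 2 * s ^+ 2 by rewrite eK.
  rewrite !exprMn bE => e.
  have -> : X ^+ 2 * (sigma ^+ 2 * s ^+ 2 - K ^+ 2) =
    sigma ^+ 2 * X ^+ 2 * s ^+ 2 - K ^+ 2 * X ^+ 2 by ring.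
  by rewrite e /X; ring.
have {}X2 : X = K * rt.
  by apply/eqP; rewrite -(@eqrXn2 _ 2)//; [rewrite X2|rewrite mulr_ge0// ltW].
have : l * s ^+ 2 = lam * s ^+ 2 by move: X2; rewrite -multiplierE /X; lra.
exact/mulIf/lt0r_neq0.
Qed.

End multiplier.

(** * The worst-case problem *)

Section worst_case.
Variables (R : realType) (g : R -> R) (F : probability R R) (mu sigma : R).
Hypotheses (dg : distortion g) (cg : concave_on01 g) (hA1 : A1 g) (hA2 : A2 g).
Hypotheses (hF : M2 F) (sF0 : 0 < stdD F) (sig0 : 0 < sigma).

Local Notation muF := (mom1 F).
Local Notation sF := (stdD F).
Local Notation gam := (gammaD g).
Local Notation Fi := (quantile F).
Local Notation V := (varU gam).
Local Notation C := (covU Fi gam).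
Local Notation h := (hlam g F mu sigma).
Local Notation wt l := (fun u => gam u + l * Fi u).

Lemma L2U_quantile (G : probability R R) : M2 G -> L2U (quantile G).
Proof.
by move=> m2; apply/(has_law_M2 (measurable_quantile G) (quantile_has_law G)).
Qed.

Lemma varU_quantile (G : probability R R) : varU (quantile G) = mom2 G - mom1 G ^+ 2.
Proof.
rewrite (has_law_mom1 (quantile_has_law G)) (has_law_mom2 (quantile_has_law G)).
by rewrite /varU /covU.
Qed.

Let hgam := L2U_gammaD cg hA1.
Let hFi := L2U_quantile hF.
Let Egam := EU_gammaD dg cg hA1.

Lemma EU_Fi : EU Fi = muF.
Proof. exact/esym/has_law_mom1/quantile_has_law. Qed.

Lemma varU_Fi : varU Fi = sF ^+ 2.
Proof. by rewrite varU_quantile sqr_sqrtr// ltW// -sqrtr_gt0. Qed.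

Lemma stdU_Fi : stdU Fi = sF.
Proof. by rewrite /stdU varU_Fi sqrtr_sqr ger0_norm// ltW. Qed.

(** Having mean 1, [gam] could only be the constant 1, which (A2) excludes. *)
Lemma gammaD_nonconstant : ~ qeq gam (cst (EU gam)).
Proof. by rewrite Egam. Qed.

Lemma V_gt0 : 0 < V.
Proof.
rewrite lt_neqAle varU_ge0// andbT; apply/eqP => /esym/(varU_eq0_ae hgam).
exact: gammaD_nonconstant.
Qed.

Lemma C_ge0 : 0 <= C.
Proof.
rewrite covUC; apply: covU_comonotone_ge0 => //.
- exact: gammaD_nondecreasing.
- exact: quantile_nondecreasing.
- exact: gammaD_nonconstant.
Qed.

Lemma wtE l : wt l = fun u => 1 * gam u + l * Fi u.
Proof. by apply/funext => u; rewrite mul1r. Qed.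

Lemma L2U_wt l : L2U (wt l).
Proof. by rewrite wtE; exact: L2U_lin. Qed.

Lemma covU_gam_wt l : covU gam (wt l) = V + l * C.
Proof. by rewrite wtE covU_linr// mul1r (covUC gam Fi). Qed.

Lemma covU_Fi_wt l : covU Fi (wt l) = C + l * sF ^+ 2.
Proof. by rewrite wtE covU_linr// mul1r -varU_Fi. Qed.

Lemma covU_wt l (q : R -> R) : L2U q -> covU (wt l) q = covU gam q + l * covU Fi q.
Proof. by move=> hq; rewrite wtE covU_linl// mul1r. Qed.

Lemma varU_wt l : varU (wt l) = V + 2 * l * C + l ^+ 2 * sF ^+ 2.
Proof.
rewrite [LHS]/varU covU_wt; last exact: L2U_wt.
by rewrite covU_gam_wt covU_Fi_wt; ring.
Qed.

Lemma varU_wt_gt0 l : 0 <= l -> 0 < varU (wt l).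
Proof.
move=> l0; rewrite varU_wt -addrA ltr_wpDr ?V_gt0// addr_ge0//.
  by rewrite !mulr_ge0// C_ge0.
by rewrite mulr_ge0// exprn_ge0// ltW.
Qed.

Lemma hlamE l : h l = standardize mu sigma (wt l).
Proof. by []. Qed.

Section fixed_multiplier.
Variable l : R.
Hypothesis l0 : 0 <= l.
Let hw := L2U_wt l.
Let Vw := varU_wt_gt0 l0.

Lemma L2U_hlam : L2U (h l). Proof. exact: L2U_standardize. Qed.

Lemma EU_hlam : EU (h l) = mu. Proof. exact: EU_standardize. Qed.

Lemma varU_hlam : varU (h l) = sigma ^+ 2. Proof. exact: varU_standardize. Qed.

Lemma covU_Fi_hlam : covU Fi (h l) = sigma / stdU (wt l) * (C + l * sF ^+ 2).
Proof. by rewrite hlamE covU_standardize// covU_Fi_wt. Qed.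

Lemma covU_gam_hlam : covU gam (h l) = sigma / stdU (wt l) * (V + l * C).
Proof. by rewrite hlamE covU_standardize// covU_gam_wt. Qed.

Lemma covU_gam_Fi_hlam :
  covU gam (h l) + l * covU Fi (h l) = sigma * stdU (wt l).
Proof.
rewrite -covU_wt; last exact: L2U_hlam.
by rewrite hlamE covU_standardize_self.
Qed.

Lemma Hq_covU (q : R -> R) : L2U q -> EU q = mu -> Hq g q = mu + covU gam q.
Proof. by move=> hq Eq; rewrite /covU Egam Eq mul1r addrC subrK. Qed.

Lemma Hq_hlam : Hq g (h l) = mu + sigma / stdU (wt l) * (V + l * C).
Proof. by rewrite (Hq_covU L2U_hlam EU_hlam) covU_gam_hlam. Qed.

Lemma Hq_hlam_corrU : Hq g (h l) = mu + sigma * stdU gam * corrU gam (wt l).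
Proof.
have b0 := stdU_gt0 Vw; have v0 := stdU_gt0 V_gt0.
rewrite Hq_hlam /corrU covU_gam_wt; congr (mu + _); field.
by rewrite !gt_eqF.
Qed.

Lemma hlam_nondecreasing : nondecreasing01 (h l).
Proof.
move=> u v u0 uv v1; rewrite /hlam lerD2l ler_pM2l// ler_pM2r; last first.
  by rewrite invr_gt0; exact: stdU_gt0.
rewrite lerD2r lerD//; first exact: gammaD_nondecreasing.
by apply: ler_wpM2l => //; exact: quantile_nondecreasing.
Qed.

End fixed_multiplier.

(* The squared Wasserstein distance from [F] to a law with quantile function
   [q], mean [mu] and standard deviation [sigma]. *)
Definition dist2 (q : R -> R) :=
  sF ^+ 2 + sigma ^+ 2 + (muF - mu) ^+ 2 - 2 * covU Fi q.

Lemma dWq_dist2 (q : R -> R) : L2U q -> EU q = mu -> varU q = sigma ^+ 2 ->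
  dWq Fi q = Num.sqrt (dist2 q) /\ 0 <= dist2 q.
Proof.
move=> hq Eq Vq.
have E2 : EU (fun u => (Fi u - q u) ^+ 2) = dist2 q.
  by rewrite EU_sqr_sub// varU_Fi Vq EU_Fi Eq /dist2; ring.
rewrite /dWq -/(EU (fun u => (Fi u - q u) ^+ 2)) E2; split=> //.
by rewrite -E2; apply: EU_ge0 => u _; exact: sqr_ge0.
Qed.

Lemma MepsP eps (G : probability R R) : (0 <= eps)%E ->
  Meps F eps mu sigma G <->
  [/\ M2 G, mom1 G = mu, mom2 G = mu ^+ 2 + sigma ^+ 2 &
      ((dist2 (quantile G))%:E <= eps)%E].
Proof.
move=> e0.
have aux : M2 G -> mom1 G = mu -> mom2 G = mu ^+ 2 + sigma ^+ 2 ->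
    ((dW F G)%:E <= sqrte eps)%E = ((dist2 (quantile G))%:E <= eps)%E.
  move=> m2 e1 e2.
  have Eq : EU (quantile G) = mu by rewrite -(has_law_mom1 (quantile_has_law G)).
  have Vq : varU (quantile G) = sigma ^+ 2.
    by rewrite varU_quantile e1 e2 addrAC subrr add0r.
  have [dE _] := dWq_dist2 (L2U_quantile m2) Eq Vq.
  by rewrite -[RHS](lee_sqrt _ e0) /dW dE.
split=> [[m2 [e1 [e2]]]|[m2 e1 e2]]; first by rewrite aux.
by rewrite -aux.
Qed.

Lemma Meps_quantile eps (G : probability R R) :
  (0 <= eps)%E -> Meps F eps mu sigma G ->
  [/\ L2U (quantile G), EU (quantile G) = mu, varU (quantile G) = sigma ^+ 2 &
      HD g G = mu + covU gam (quantile G)].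
Proof.
move=> e0 /(MepsP _ e0)[m2 e1 e2 _].
have hq := L2U_quantile m2.
have Eq : EU (quantile G) = mu by rewrite -(has_law_mom1 (quantile_has_law G)).
split=> //; last exact: Hq_covU.
by rewrite varU_quantile e1 e2 addrAC subrr add0r.
Qed.

(* Complementary slackness: adding [l] times the constraint on [covU Fi q] to
   the objective turns it into [covU (gam + l Fi) q], maximised at [h l] by
   Cauchy-Schwarz. *)
Lemma hlam_optimal eps l : (0 <= eps)%E -> 0 <= l ->
  ((dist2 (h l))%:E <= eps)%E -> (0 < l -> eps = (dist2 (h l))%:E) ->
  [/\ exists G, maximiser g F eps mu sigma G /\ qeq (quantile G) (h l),
      forall G, maximiser g F eps mu sigma G -> qeq (quantile G) (h l) &
      supH g F eps mu sigma = (Hq g (h l))%:E].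
Proof.
move=> e0 l0 feas slack.
have hh := L2U_hlam l0; have Eh := EU_hlam l0; have Vh := varU_hlam l0.
have Vw := varU_wt_gt0 l0; have hw := L2U_wt l.
have [G [m2 e1 e2 qh]] := ex_law_quantile hh (hlam_nondecreasing l0).
have hq := L2U_quantile m2.
have covE f : L2U f -> covU f (quantile G) = covU f (h l).
  by move=> hf; exact: covU_ae.
have GM : Meps F eps mu sigma G.
  apply/MepsP => //; split=> //; first by rewrite e1.
    rewrite e2; move: Vh; rewrite /varU /covU Eh => /eqP.
    rewrite subr_eq => /eqP Vh; rewrite addrC -expr2 in Vh; rewrite -Vh.
    by apply: EU_eq => u _; rewrite expr2.
  by rewrite /dist2 covE.
have HG : HD g G = mu + covU gam (h l).
  by have [_ _ _ ->] := Meps_quantile e0 GM; rewrite covE.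
have HGh : HD g G = Hq g (h l) by rewrite HG Hq_covU.
have slackle G' : Meps F eps mu sigma G' ->
    l * covU Fi (h l) <= l * covU Fi (quantile G').
  move=> /(MepsP _ e0)[_ _ _ +].
  move: l0; rewrite le_eqVlt => /predU1P[<-|lp]; first by rewrite !mul0r.
  by rewrite {1}slack// lee_fin ler_pM2l// /dist2; lra.
have bound G' : Meps F eps mu sigma G' -> HD g G' <= HD g G.
  move=> G'M; have [hq' Eq' Vq' ->] := Meps_quantile e0 G'M.
  rewrite HG lerD2l.
  have := covU_le_std hw Vw hq' sig0 Vq'; rewrite covU_wt//.
  by rewrite -covU_gam_Fi_hlam//; have := slackle _ G'M; lra.
split.
- by exists G; split=> //; split.
(* A maximiser does at least as well as [G] and satisfies the slackness inequality, so it attains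
   the Cauchy-Schwarz bound. *)
- move=> G' [G'M G'max]; have [hq' Eq' Vq' HG'] := Meps_quantile e0 G'M.
  rewrite hlamE -Eq'; apply: covU_eq_std => //.
  rewrite -covU_gam_Fi_hlam// covU_wt//.
  have := slackle _ G'M; have := G'max _ GM; rewrite HG HG'; lra.
- rewrite -HGh; apply/eqP; rewrite eq_le; apply/andP; split.
    by apply: ge_ereal_sup => _ [G' G'M <-]; rewrite lee_fin bound.
  by apply: ereal_sup_ubound; exists G.
Qed.

Local Notation c0 := (corrU Fi gam).
Local Notation D0 := ((muF - mu) ^+ 2 + (sF - sigma) ^+ 2).
Local Notation D1 := (D0 + 2 * sigma * sF * (1 - c0)).

Lemma stdD_corrU : sF * c0 = C / stdU gam.
Proof.
rewrite /corrU stdU_Fi; field.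
by rewrite !gt_eqF// stdU_gt0// V_gt0.
Qed.

Lemma unconstrained_optimal eps : (D1%:E <= eps)%E -> (D0%:E < eps)%E ->
  [/\ exists G, maximiser g F eps mu sigma G /\ qeq (quantile G) (h 0),
      forall G, maximiser g F eps mu sigma G -> qeq (quantile G) (h 0) &
      supH g F eps mu sigma = (mu + sigma * stdU gam)%:E].
Proof.
move=> D1e D0e.
have e0 : (0 <= eps)%E.
  by apply: le_trans (ltW D0e); rewrite lee_fin addr_ge0// sqr_ge0.
have w0 : stdU (wt 0) = stdU gam.
  by rewrite /stdU varU_wt; congr Num.sqrt; ring.
have v0 := stdU_gt0 V_gt0.
(* The threshold [D1] is exactly the squared distance from [F] to [h 0]. *)
have dE : dist2 (h 0) = D1.
  rewrite /dist2 covU_Fi_hlam// w0 mul0r addr0.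
  have -> : sigma / stdU gam * C = sigma * (sF * c0) by rewrite stdD_corrU; ring.
  by ring.
have HE : Hq g (h 0) = mu + sigma * stdU gam.
  rewrite Hq_hlam// w0 mul0r addr0 -(sqr_stdU V_gt0).
  by field; rewrite gt_eqF.
rewrite -HE; apply: hlam_optimal => //; first by rewrite dE.
by rewrite ltxx.
Qed.

(** * The regime where the Wasserstein constraint is active *)

Section constrained.
Variable e : R.
Hypotheses (D0e : D0 < e) (eD1 : e < D1).

Local Notation K :=
  ((muF ^+ 2 + sF ^+ 2 + mu ^+ 2 + sigma ^+ 2 - 2 * mu * muF - e) / 2).
Local Notation lam := (multiplier V C sF sigma K).

Let KC : sigma * C < K * stdU gam.
Proof.
have v0 := stdU_gt0 V_gt0.
have -> : sigma * C = sigma * (sF * c0) * stdU gam.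
  by rewrite stdD_corrU; field; rewrite gt_eqF.
by rewrite ltr_pM2r//; move: eD1; lra.
Qed.

Let Ks : K < sigma * sF.
Proof. move: D0e; lra. Qed.

Lemma K_gt0 : 0 < K.
Proof. exact: (multiplier_K_gt0 V_gt0 C_ge0 sig0 KC). Qed.

Lemma dist2_K (q : R -> R) : (dist2 q = e) <-> (covU Fi q = K).
Proof. by rewrite /dist2; split; lra. Qed.

Lemma lam_gt0 : 0 < lam.
Proof. exact: (multiplier_gt0 V_gt0 C_ge0 sF0 sig0 KC Ks). Qed.

Let lam0 := ltW lam_gt0.

Lemma dist2_hlam : dist2 (h lam) = e.
Proof.
apply/dist2_K; rewrite covU_Fi_hlam// /stdU varU_wt.
exact: (multiplier_sol V_gt0 C_ge0 sF0 sig0 KC Ks).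
Qed.

Lemma dWq_hlam : dWq Fi (h lam) = Num.sqrt e.
Proof.
have [-> _] := dWq_dist2 (L2U_hlam lam0) (EU_hlam lam0) (varU_hlam lam0).
by rewrite dist2_hlam.
Qed.

Lemma dWq_hlam_uniq l : 0 < l -> dWq Fi (h l) = Num.sqrt e -> l = lam.
Proof.
move=> lp; have l0 := ltW lp.
have [-> d0] := dWq_dist2 (L2U_hlam l0) (EU_hlam l0) (varU_hlam l0).
have e0 : 0 <= e.
  by apply: le_trans (ltW D0e); rewrite addr_ge0// sqr_ge0.
move=> /eqP; rewrite eqr_sqrt// => /eqP /dist2_K.
rewrite covU_Fi_hlam// /stdU varU_wt.
exact: (multiplier_uniq V_gt0 C_ge0 sF0 sig0 KC Ks).
Qed.

Lemma constrained_optimal :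
  [/\ exists G, maximiser g F e%:E mu sigma G /\ qeq (quantile G) (h lam),
      forall G, maximiser g F e%:E mu sigma G -> qeq (quantile G) (h lam) &
      supH g F e%:E mu sigma = (Hq g (h lam))%:E].
Proof.
apply: hlam_optimal => //; rewrite ?dist2_hlam//.
by rewrite lee_fin; apply: le_trans (ltW D0e); rewrite addr_ge0// sqr_ge0.
Qed.

(** Replacing [b_lambda] by [sigma * rt] leaves [e] only inside explicit functions of [K], from
    which continuity in [e] can be read off. *)
Lemma supH_constrained : supH g F e%:E mu sigma =
  (mu + (multiplier_root V C sF sigma K)^-1 * (V + lam * C))%:E.
Proof.
have [_ _ ->] := constrained_optimal; rewrite Hq_hlam//; congr ((_ + _ * _)%:E).
rewrite /stdU varU_wt (multiplier_sqrt_W V_gt0 C_ge0 sF0 sig0 KC Ks).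
have rt0 := multiplier_root_gt0 V_gt0 C_ge0 sF0 sig0 KC Ks.
by field; rewrite !gt_eqF.
Qed.

Lemma multiplier_root_neq0 : multiplier_root V C sF sigma K != 0.
Proof. by rewrite gt_eqF// (multiplier_root_gt0 V_gt0 C_ge0 sF0 sig0 KC Ks). Qed.

Lemma multiplier_den_neq0 : K ^+ 2 - sigma ^+ 2 * sF ^+ 2 != 0.
Proof.
have := K_gt0 => K0.
rewrite -exprMn subr_sqr mulf_neq0//; first by rewrite lt_eqF// subr_lt0.
by rewrite gt_eqF// addr_gt0// mulr_gt0.
Qed.

End constrained.

Lemma supH_continuous : {within [set x : R | D0 < x < D1],
  continuous (fun x : R => supH g F x%:E mu sigma)}.
Proof.
apply: continuous_in_subspaceT => x; rewrite inE /= => /andP[xD0 xD1].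
pose K y := (muF ^+ 2 + sF ^+ 2 + mu ^+ 2 + sigma ^+ 2 - 2 * mu * muF - y) / 2.
pose rt y := multiplier_root V C sF sigma (K y).
pose lam y := multiplier V C sF sigma (K y).
pose val y := mu + (rt y)^-1 * (V + lam y * C).
have cK : K y @[y --> x] --> K x.
  by apply: cvgMl; apply: cvgB; [exact: cvg_cst|exact: cvg_id].
have crt : rt y @[y --> x] --> rt x.
  apply: (cvg_comp _ Num.sqrt); last exact: sqrt_continuous.
  apply: cvgMr; apply: cvgV; first exact: multiplier_den_neq0.
  by apply: cvgB; [rewrite expr2; exact: cvgM|exact: cvg_cst].
have cval : val y @[y --> x] --> val x.
  apply: cvgD; first exact: cvg_cst.
  apply: cvgM; first by apply: cvgV => //; exact: multiplier_root_neq0.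
  apply: cvgD; first exact: cvg_cst.
  apply: cvgMl; apply: cvgB; last exact: cvg_cst.
  by apply: cvgM => //; apply: cvgMl.
(* The closed form holds on the open interval between [D0] and [D1], hence near [x], which is enough
   to transfer the limit. *)
rewrite /continuous_at supH_constrained//.
have : (val y)%:E @[y --> x] --> (val x)%:E by apply: cvg_EFin => //; near=> y.
apply: cvg_trans; apply: near_eq_cvg; near=> y.
rewrite supH_constrained//; near: y.
- exact: lt_nbhsr.
- exact: lt_nbhsl.
Unshelve. all: by end_near. Qed.

End worst_case.
Theorem theorem1 (R : realType) (g : R -> R) (F : probability R R)
    (mu sigma : R) (eps : \bar R) :
  distortion g -> concave_on01 g -> A1 g -> A2 g ->
  M2 F -> 0 < stdD F -> 0 < sigma -> (0 <= eps)%E ->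
  let muF := mom1 F in
  let sF := stdD F in
  let gam := gammaD g in
  let Fi := quantile F in
  let c0 := corrU Fi gam in
  let V := varU gam in
  let C := covU Fi gam in
  let h := hlam g F mu sigma in
  let D0 := (muF - mu) ^+ 2 + (sF - sigma) ^+ 2 in
  let D1 := D0 + 2 * sigma * sF * (1 - c0) in
  (* (A3) *)
  (D0%:E < eps)%E ->
  (* part 1 *)
  (c0 < 1 -> (eps < D1%:E)%E ->
    let e := fine eps in
    let K := (muF ^+ 2 + sF ^+ 2 + mu ^+ 2 + sigma ^+ 2 - 2 * mu * muF - e) / 2 in
    let lam := K / sF ^+ 2 *
                 Num.sqrt ((C ^+ 2 - V * sF ^+ 2) / (K ^+ 2 - sigma ^+ 2 * sF ^+ 2))
               - C / sF ^+ 2 in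
    let w := fun u => gam u + lam * Fi u in
    [/\ 0 <= K,
        [/\ 0 < lam, dWq Fi (h lam) = Num.sqrt e &
             forall l, 0 < l -> dWq Fi (h l) = Num.sqrt e -> l = lam],
        ((exists G, maximiser g F eps mu sigma G /\ qeq (quantile G) (h lam)) /\
         (forall G, maximiser g F eps mu sigma G -> qeq (quantile G) (h lam))),
        [/\ supH g F eps mu sigma = (Hq g (h lam))%:E,
             Hq g (h lam) = mu + sigma / stdU w * (V + lam * C) &
             Hq g (h lam) = mu + sigma * stdU gam * corrU gam w] &
        {within [set x : R | D0 < x < D1],
           continuous (fun x : R => supH g F x%:E mu sigma)}]) /\
  (* part 2 *)
  ((D1%:E <= eps)%E ->
    [/\ (exists G, maximiser g F eps mu sigma G /\ qeq (quantile G) (h 0)),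
        (forall G, maximiser g F eps mu sigma G -> qeq (quantile G) (h 0)) &
        supH g F eps mu sigma = (mu + sigma * stdU gam)%:E]).
Proof.
move=> dg cg hA1 hA2 hF sF0 sig0 _ muF sF gam Fi c0 V C h D0 D1 D0e.
split; last by move=> D1e; exact: unconstrained_optimal.
(* [eps < D1] rules out [+oo] and [D0 < eps] rules out [-oo], so [fine eps] is the true radius. *)
move=> _; case: eps D0e => [e|//|//]; rewrite !lte_fin => D0e eD1 /=.
set K := (X in 0 <= X); set lam := K / _ * _ - _.
have lamp : 0 < lam by exact: lam_gt0.
have [exG uG supE] := constrained_optimal dg cg hA1 hA2 hF sF0 sig0 D0e eD1.
split=> //.
- exact/ltW/(K_gt0 dg cg hA1 hA2 hF sF0 sig0).
- split=> //; first exact: dWq_hlam.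
  by move=> l; exact: dWq_hlam_uniq.
- split=> //; first by apply: Hq_hlam => //; exact: ltW.
  by apply: Hq_hlam_corrU => //; exact: ltW.
- exact: supH_continuous.
Qed.
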